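(* Let $\Delta t>0$ and let $\Omega\subset\mathbb{R}^3$ be a box with periodic boundary conditions in $\boldsymbol{x}$. Let $(f^n,\boldsymbol{E}^n,\boldsymbol{B}^n)_{n\ge 0}$, together with the intermediate states $f^{n+1,*}$, be produced by Scheme-I (the time-discrete scheme for the Vlasov-Maxwell system described in the context), and let $\rho^n,\boldsymbol{u}^n,\mathcal{T}^n$ be the density, macroscopic velocity and temperature of $f^n$. Then Scheme-I preserves the discrete total energy: for every $n\ge 0$, $$\mathcal{E}_{\rm total}^{n+1}=\mathcal{E}_{\rm total}^{n},$$ where $$\mathcal{E}_{\rm total}^n=\frac12\int_\Omega \rho^n\left(|\boldsymbol{u}^n|^2+3\mathcal{T}^n\right)\,d\boldsymbol{x}+\frac12\int_\Omega\left(|\boldsymbol{E}^n|^2+|\boldsymbol{B}^n|^2\right)d\boldsymbol{x}.$$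
   Context: **Vlasov-Maxwell system.** The continuous system is $\partial_t f+\boldsymbol{v}\cdot\nabla_{\boldsymbol{x}}f+(\boldsymbol{E}+\boldsymbol{v}\times\boldsymbol{B})\cdot\nabla_{\boldsymbol{v}}f=0$, $\partial_t\boldsymbol{E}-\nabla_{\boldsymbol{x}}\times\boldsymbol{B}=-\boldsymbol{J}$, $\partial_t\boldsymbol{B}+\nabla_{\boldsymbol{x}}\times\boldsymbol{E}=0$, with $\boldsymbol{J}=\int_{\mathbb{R}^3}\boldsymbol{v}f\,d\boldsymbol{v}$, $\boldsymbol{x}\in\Omega$, $\boldsymbol{v}\in\mathbb{R}^3$. **Macroscopic quantities.** For a distribution function $f(\boldsymbol{x},\boldsymbol{v})$, the density $\rho$ (assumed positive), velocity $\boldsymbol{u}$ and temperature $\mathcal{T}$ (assumed positive) are defined by $\rho=\int_{\mathbb{R}^3}f\,d\boldsymbol{v}$, $\rho\boldsymbol{u}=\int_{\mathbb{R}^3}\boldsymbol{v}f\,d\boldsymbol{v}$, $\frac12\rho|\boldsymbol{u}|^2+\frac32\rho\mathcal{T}=\frac12\int_{\mathbb{R}^3}|\boldsymbol{v}|^2f\,d\boldsymbol{v}$. All functions are taken smooth and periodic in $\boldsymbol{x}$, and sufficiently decaying in $\boldsymbol{v}$ for all integrals to make sense. **Hermite expansion.** For $\alpha\in\mathbb{N}^3$ (with $0\in\mathbb{N}$), $|\alpha|=\alpha_1+\alpha_2+\alpha_3$, let $$\mathcal{H}_{\mathcal{T},\alpha}(\boldsymbol{\xi})=\frac{1}{(2\pi)^{3/2}}\mathcal{T}^{-\frac{|\alpha|+3}{2}}\prod_{d=1}^3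 H_{\alpha_d}(\xi_d)\exp(-\xi_d^2/2),\qquad H_k(x)=(-1)^ke^{x^2/2}\frac{d^k}{dx^k}e^{-x^2/2}.$$ A distribution function $f$ is expanded as $f=\sum_\alpha f_\alpha(\boldsymbol{x})\,\mathcal{H}_{\mathcal{T},\alpha}\big((\boldsymbol{v}-\boldsymbol{u})/\sqrt{\mathcal{T}}\big)$ with $\boldsymbol{u},\mathcal{T}$ its own velocity and temperature; consequently $f_0=\rho$, $f_{e_i}=0$ and $\sum_{d=1}^3f_{2e_d}=0$, where $e_i$ is the $i$-th unit multi-index. $f_\alpha$ is zero if a component of $\alpha$ is negative. The expansion is truncated at order $|\alpha|\le M$. $\epsilon_{dlm}$ is the Levi-Civita symbol. **Scheme-I.** Given $(f^n,\boldsymbol{E}^n,\boldsymbol{B}^n)$, the next state satisfies $$\frac{f^{n+1,*}-f^n}{\Delta t}=-\boldsymbol{v}\cdot\nabla_{\boldsymbol{x}}f^n,$$ $$\frac{\boldsymbol{B}^{n+1}-\boldsymbol{B}^n}{\Delta t}=-\nabla_{\boldsymbol{x}}\times\frac{\boldsymbol{E}^n+\boldsymbol{E}^{n+1}}{2},$$ $$\frac{\boldsymbol{E}^{n+1}-\boldsymbol{E}^n}{\Delta t}=\nabla_{\boldsymbol{x}}\times\frac{\boldsymbol{B}^n+\boldsymbol{B}^{n+1}}{2}-\boldsymbol{J}^{n+1/2},$$ $$\frac{\boldsymbol{u}^{n+1}-\boldsymbol{u}^{n+1,*}}{\Delta t}=\frac{\boldsymbol{E}^n+\boldsymbol{E}^{n+1}}{2}+\frac{\boldsymbol{u}^{n+1,*}+\boldsymbol{u}^{n+1}}{2}\times\frac{\boldsymbol{B}^n+\boldsymbol{B}^{n+1}}{2},$$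 $$\frac{f_\alpha^{n+1}-f_\alpha^{n+1,*}}{\Delta t}=\sum_{d,l,m=1}^3\epsilon_{dlm}(\alpha_l+1)\frac{B_m^n+B_m^{n+1}}{2}f^{n+1,*}_{\alpha-e_d+e_l},\qquad 2\le|\alpha|\le M.$$ Here $\rho^{n+1,*},\boldsymbol{u}^{n+1,*},\mathcal{T}^{n+1,*}$ are the density, velocity and temperature of $f^{n+1,*}$, and $f_\alpha^{n+1,*}$ its Hermite coefficients with respect to $\boldsymbol{u}^{n+1,*},\mathcal{T}^{n+1,*}$. The density and temperature are unchanged in the Lorentz step: $\rho^{n+1}=\rho^{n+1,*}$, $\mathcal{T}^{n+1}=\mathcal{T}^{n+1,*}$. The current is $$\boldsymbol{J}^{n+1/2}=\int_{\mathbb{R}^3}\boldsymbol{v}\,\frac{f^{n+1,*}+f^{n+1}}{2}\,d\boldsymbol{v}=\frac{\rho^{n+1,*}(\boldsymbol{u}^{n+1}+\boldsymbol{u}^{n+1,*})}{2}.$$ The new function $f^{n+1}$ is $\sum_{|\alpha|\le M}f_\alpha^{n+1}\mathcal{H}_{\mathcal{T}^{n+1},\alpha}\big((\boldsymbol{v}-\boldsymbol{u}^{n+1})/\sqrt{\mathcal{T}^{n+1}}\big)$, with $f_0^{n+1}=\rho^{n+1}$ and $f^{n+1}_{e_i}=0$; its density, velocity and temperature are $\rho^{n+1},\boldsymbol{u}^{n+1},\mathcal{T}^{n+1}$. *)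

(* Defs.v *)
From mathcomp Require Import all_boot all_order all_algebra.
From mathcomp Require Import all_classical all_reals all_analysis.

Set Implicit Arguments.
Unset Strict Implicit.
Unset Printing Implicit Defensive.

Import Order.TTheory GRing.Theory Num.Theory.
Import numFieldNormedType.Exports.

Local Open Scope classical_set_scope.
Local Open Scope ring_scope.

Section R3.
Variable R : realType.
Local Notation vec := 'rV[R]_3.

Definition unitv (d : 'I_3) : vec := delta_mx 0 d.

(* Indices are 0, 1, 2 and the additions are those of 'I_3, i.e. modulo 3. *)
Definition levi_civita (d l m : 'I_3) : R :=
  if (l == d + 1) && (m == d + 1 + 1) then 1
  else if (l == d + 1 + 1) && (m == d + 1) then -1
  else 0.

Definition cross (a b : vec) : vec :=
  \row_d \sum_l \sum_m levi_civita d l m * a 0 l * b 0 m.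

(* Squared Euclidean norm; the library norm `|a| of a row vector is the
   maximum norm. *)
Definition sqnorm (a : vec) : R := \sum_d a 0 d ^+ 2.

Definition partial (d : 'I_3) (g : vec -> R) (x : vec) : R :=
  'D_(unitv d) g x.

Definition curl (F : vec -> vec) (x : vec) : vec :=
  \row_d \sum_l \sum_m
    levi_civita d l m * partial l (fun y => F y 0 m) x.

Definition mkvec (p : R * R * R) : vec :=
  \row_(d < 3) [tuple p.1.1; p.1.2; p.2]`_d.

Definition integral3 (D : set vec) (g : vec -> R) : R :=
  Rintegral ((@lebesgue_measure R \x @lebesgue_measure R)
               \x @lebesgue_measure R)%E
            (mkvec @^-1` D) (g \o mkvec).

Definition integral3_vec (D : set vec) (g : vec -> vec) : vec :=
  \row_d integral3 D (fun v => g v 0 d).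

Definition box (a L : vec) : set vec :=
  [set x | forall d : 'I_3, a 0 d <= x 0 d <= a 0 d + L 0 d].

Definition periodic (L : vec) (T : Type) (g : vec -> T) : Prop :=
  forall (d : 'I_3) (x : vec), g (x + L 0 d *: unitv d) = g x.

Fixpoint Ck (k : nat) (V : normedModType R) (g : V -> R) : Prop :=
  continuous g /\
  (if k is j.+1 then
     forall w : V, (forall x : V, derivable g x w) /\ Ck j (fun x => 'D_w g x)
   else True).

Definition smooth (V : normedModType R) (g : V -> R) : Prop :=
  forall k, Ck k g.

Definition rapid_decay (g : vec -> vec -> R) : Prop :=
  forall k : nat, exists C : R,
    forall x v : vec, (1 + `|v|) ^+ k * `|g x v| <= C.

Definition regular_distribution (L : vec) (f : vec -> vec -> R) : Prop :=
  [/\ smooth (fun z : vec * vec => f z.1 z.2),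
      periodic L f,
      rapid_decay f &
      forall d : 'I_3,
        rapid_decay (fun x v => partial d (fun y => f y v) x)].

Definition regular_field (L : vec) (F : vec -> vec) : Prop :=
  (forall d : 'I_3, smooth (fun x => F x 0 d)) /\ periodic L F.

Definition macroscopic (f : vec -> vec -> R)
    (rho : vec -> R) (u : vec -> vec) (T : vec -> R) : Prop :=
  forall x : vec,
    [/\ 0 < rho x, 0 < T x,
        rho x = integral3 setT (f x),
        rho x *: u x = integral3_vec setT (fun v => f x v *: v) &
        1/2 * rho x * sqnorm (u x) + 3/2 * rho x * T x =
          1/2 * integral3 setT (fun v => sqnorm v * f x v)].

Definition multiindex := {ffun 'I_3 -> nat}.

Definition mi_order (al : multiindex) : nat := (\sum_d al d)%N.

Definition unit_index (d : 'I_3) : multiindex := [ffun i => nat_of_bool (i == d)].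

Definition hermite_poly (k : nat) (x : R) : R :=
  (-1) ^+ k * expR (x ^+ 2 / 2)
    * derive1n k (fun y : R => expR (- (y ^+ 2 / 2))) x.

Definition hermite_basis (T : R) (al : multiindex) (xi : vec) : R :=
  (2 * pi) `^ (- (3 / 2)) * T `^ (- ((mi_order al + 3)%:R / 2))
    * \prod_d (hermite_poly (al d) (xi 0 d) * expR (- (xi 0 d ^+ 2 / 2))).

(* Sum over |alpha| <= N; every such alpha has entries at most N. *)
Definition hermite_sum (N : nat) (u : vec) (T : R) (c : multiindex -> R)
    (v : vec) : R :=
  \sum_(b : {ffun 'I_3 -> 'I_N.+1} |
          (mi_order [ffun d => nat_of_ord (b d)] <= N)%N)
    c [ffun d => nat_of_ord (b d)]
      * hermite_basis T [ffun d => nat_of_ord (b d)]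
          ((Num.sqrt T)^-1 *: (v - u)).

(* f = \sum_alpha c_alpha H_(T,alpha)((v - u)/sqrt T), where the series is
   understood in the sense of convergence of all velocity moments.  This
   determines the c_alpha (the moments of degree at most k involve only the
   coefficients with |alpha| <= k), it is implied by convergence in the
   L^2 space with weight exp(|v - u|^2/(2T)), and it does not require f to
   belong to that space. *)
Definition hermite_expansion (f : vec -> R) (u : vec) (T : R)
    (c : multiindex -> R) : Prop :=
  forall p : multiindex,
    (fun N => integral3 setT
       (fun v => (\prod_d v 0 d ^+ p d) * hermite_sum N u T c v)) @ \oo
    --> integral3 setT (fun v => (\prod_d v 0 d ^+ p d) * f v).

(* Coefficients are zero as soon as a component of the index is negative. *)
Definition coeff_ext (c : multiindex -> R) (b : {ffun 'I_3 -> int}) : R :=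
  if [forall d, 0 <= b d] then c [ffun d => absz (b d)] else 0.

Definition int_index (al : multiindex) : {ffun 'I_3 -> int} :=
  [ffun d => Posz (al d)].

Definition current (fs f : vec -> vec -> R) (x : vec) : vec :=
  integral3_vec setT (fun v => ((fs x v + f x v) / 2) *: v).

Definition midpoint (a b : vec) : vec := 2^-1 *: (a + b).

(* One step of the scheme, from (f0, E0, B0) to (f1, E1, B1) through the
   intermediate distribution fs. *)
Definition schemeI_step (M : nat) (dt : R)
    (f0 : vec -> vec -> R) (E0 B0 : vec -> vec)
    (fs : vec -> vec -> R)
    (rhos : vec -> R) (us : vec -> vec) (Ts : vec -> R)
    (cs : multiindex -> vec -> R)
    (f1 : vec -> vec -> R) (E1 B1 : vec -> vec)
    (rho1 : vec -> R) (u1 : vec -> vec) (T1 : vec -> R)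
    (c1 : multiindex -> vec -> R) : Prop :=
  let Em x := midpoint (E0 x) (E1 x) in
  let Bm x := midpoint (B0 x) (B1 x) in
  (forall x v : vec,
     (fs x v - f0 x v) / dt
       = - \sum_d v 0 d * partial d (fun y => f0 y v) x) /\
  (forall x : vec, dt^-1 *: (B1 x - B0 x) = - curl Em x) /\
  (forall x : vec, dt^-1 *: (E1 x - E0 x) = curl Bm x - current fs f1 x) /\
  (forall x : vec,
     dt^-1 *: (u1 x - us x) = Em x + cross (midpoint (us x) (u1 x)) (Bm x)) /\
  (forall x : vec, rho1 x = rhos x /\ T1 x = Ts x) /\
  (forall x : vec,
     hermite_expansion (fs x) (us x) (Ts x) (fun al => cs al x)) /\
  (forall (al : multiindex) (x : vec), (2 <= mi_order al <= M)%N ->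
     (c1 al x - cs al x) / dt
       = \sum_d \sum_l \sum_m
           levi_civita d l m * (al l).+1%:R * Bm x 0 m
           * coeff_ext (fun be => cs be x)
               (int_index al - int_index (unit_index d)
                 + int_index (unit_index l))) /\
  (forall x : vec, c1 0 x = rho1 x /\ forall i, c1 (unit_index i) x = 0) /\
  (forall x v : vec,
     f1 x v = hermite_sum M (u1 x) (T1 x) (fun al => c1 al x) v).

Definition total_energy (Omega : set vec)
    (rho : vec -> R) (u : vec -> vec) (T : vec -> R) (E B : vec -> vec) : R :=
  1/2 * integral3 Omega (fun x => rho x * (sqnorm (u x) + 3 * T x))
  + 1/2 * integral3 Omega (fun x => sqnorm (E x) + sqnorm (B x)).

End R3.

(* Main.v *)
Require Import Defs.
From HB Require Import structures.
From mathcomp Require Import all_boot all_order all_algebra.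
From mathcomp Require Import all_classical all_reals all_analysis.
From mathcomp Require Import measurable_realfun ring lra.
Import Order.TTheory GRing.Theory Num.Theory.
Import numFieldNormedType.Exports.
Local Open Scope ring_scope.

(* By definition of the temperature, rho (|u|^2 + 3 T) is the second velocity
   moment of f.  The free transport step preserves its integral: by Fubini the
   change is a combination of velocity integrals of |v|^2 v_d times the
   integral over the box of the periodic derivative d_(x_d) f, which vanishes.
   In the Lorentz step, testing the equation for u against the mean velocity
   kills the magnetic force, so the kinetic energy density grows by dt E.J with
   E the mean electric field and J exactly the current entering Ampere's law.
   Testing the Maxwell equations against the mean fields gives -dt E.J plus
   dt (E.curl B - B.curl E), the divergence of a periodic vector field. *)

Set Implicit Arguments.
Unset Strict Implicit.
Local Open Scope classical_set_scope.

(** * Measurability of continuous functions *)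

Section countable_base.

(* [M] is a bare collection of sets because the library has no structure joining
   measurable and topological spaces. *)
Definition countable_base_in (X : topologicalType) (M : set (set X)) : Prop :=
  exists2 B : nat -> set X, (forall n, M (B n)) &
    forall (x : X) (U : set X), nbhs x U -> exists2 n, B n x & B n `<=` U.

(** Open intervals with rational endpoints form the base. They are indexed by pickled pairs of
    rationals, and a code of no pair gives the empty set. *)
Lemma countable_base_in_real (R : realType) :
  @countable_base_in R (@measurable _ (measurableTypeR R)).
Proof.
pose B (n : nat) : set R :=
  if @unpickle (rat * rat)%type n is Some q
  then `]ratr q.1, ratr q.2[ else set0.
exists B => [n|x U /nbhs_ballP[e /= e0 eU]].
  rewrite /B; case: (unpickle n) => [q|]; last exact: measurable0.
  exact: measurable_itv.
have /rat_in_itvoo[p /itvP px] : x - e < x by rewrite ltrBlDr ltrDl.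
have /rat_in_itvoo[q /itvP qx] : x < x + e by rewrite ltrDl.
exists (pickle (p, q)); rewrite /B pickleK /=.
  by rewrite in_itv /= px qx.
move=> y /=; rewrite in_itv /= => /andP[py yq]; apply: eU.
rewrite /ball /= ltr_distlC; apply/andP; split.
  by rewrite (lt_trans _ py)// px.
by rewrite (lt_trans yq)// qx.
Qed.

Lemma countable_base_in_prod (X Y : topologicalType) (MX : set (set X))
    (MY : set (set Y)) (MXY : set (set (X * Y))) :
  (forall A B, MX A -> MY B -> MXY (A `*` B)) ->
  countable_base_in MX -> countable_base_in MY -> countable_base_in MXY.
Proof.
move=> MM [A MA bA] [B MB bB].
(* A code of no pair is sent to a rectangle instead of [set0], since [MXY] is only known to contain
   rectangles. *)
exists (fun n => if @unpickle (nat * nat)%type n is Some k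
                 then A k.1 `*` B k.2 else A 0%N `*` B 0%N) => [n|].
  by case: (unpickle n) => [k|]; exact: MM.
move=> [x y] U [[V W] /= [xV yW] VWU].
have [n An AV] := bA _ _ xV; have [m Bm BW] := bB _ _ yW.
exists (pickle (n, m)); rewrite pickleK//=.
by move=> [x' y'] [/= Ax' By']; apply: VWU; split; [exact: AV|exact: BW].
Qed.

(** An open set is the union of the base sets that it contains, and this union is countable. Base
    sets not contained in [U] are replaced by [set0] to keep the index set [nat]. *)
Lemma countable_base_in_open (X : topologicalType) (M : set (set X)) :
  M set0 -> (forall F : nat -> set X, (forall n, M (F n)) -> M (\bigcup_n F n)) ->
  countable_base_in M -> forall U, open U -> M U.
Proof.
move=> M0 MU [B MB bB] U oU.
suff -> : U = \bigcup_n (if `[< B n `<=` U >] then B n else set0).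
  by apply: MU => n; case: ifP.
apply/seteqP; split => [x Ux|x [n _]].
  have [n Bx BU] := bB x U (open_nbhs_nbhs (conj oU Ux)).
  by exists n => //; case: ifPn => // /asboolPn.
by case: ifPn => // /asboolP BU /BU.
Qed.

(** [X] carries a topology only, so measurability is tested on the sets whose preimage under [phi]
    is measurable. Open intervals generate the Borel sets of the line, their preimages under [g] are
    open, and the countable base puts open sets in that collection. *)
Lemma continuous_comp_measurable (R : realType) (X : topologicalType)
    d (T : measurableType d) (phi : T -> X) (g : X -> R) :
  countable_base_in [set A | measurable (phi @^-1` A)] ->
  continuous g -> measurable_fun [set: T] (g \o phi).
Proof.
move=> bX /continuousP cg; apply: (measurability _ (RGenOpens.measurableE R)).
move=> _ [_ [a [b ->] <-]]; rewrite setTI comp_preimage.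
apply: (countable_base_in_open _ _ bX) => //=.
- by rewrite preimage_set0; exact: measurable0.
- by move=> F mF; rewrite preimage_bigcup; exact: bigcupT_measurable.
- exact/cg/interval_open.
Qed.

End countable_base.

(** * Coordinates on three-dimensional space and on phase space *)

Section mkvec.
Variable R : realType.
Local Notation vec := 'rV[R]_3.
Local Notation R3 := (measurableTypeR R * measurableTypeR R * measurableTypeR R)%type.

Definition o0 : 'I_3 := Ordinal (isT : 0 < 3)%N.
Definition o1 : 'I_3 := Ordinal (isT : 1 < 3)%N.
Definition o2 : 'I_3 := Ordinal (isT : 2 < 3)%N.

Lemma ord3P (P : 'I_3 -> Prop) : P o0 -> P o1 -> P o2 -> forall d, P d.
Proof.
move=> P0 P1 P2 [[|[|[|//]]] i].
- by rewrite (_ : Ordinal i = o0)//; exact: val_inj.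
- by rewrite (_ : Ordinal i = o1)//; exact: val_inj.
- by rewrite (_ : Ordinal i = o2)//; exact: val_inj.
Qed.

Lemma sum3E (V : nmodType) (F : 'I_3 -> V) : \sum_d F d = F o0 + F o1 + F o2.
Proof.
rewrite !big_ord_recr big_ord0 /= add0r.
by congr (_ + _ + _); congr F; exact: val_inj.
Qed.

Lemma mkvec0 (p : R * R * R) : mkvec p 0 o0 = p.1.1.
Proof. by rewrite mxE. Qed.
Lemma mkvec1 (p : R * R * R) : mkvec p 0 o1 = p.1.2.
Proof. by rewrite mxE. Qed.
Lemma mkvec2 (p : R * R * R) : mkvec p 0 o2 = p.2.
Proof. by rewrite mxE. Qed.
Definition mkvecE := (mkvec0, mkvec1, mkvec2).

Lemma rV3P (x y : vec) :
  x 0 o0 = y 0 o0 -> x 0 o1 = y 0 o1 -> x 0 o2 = y 0 o2 -> x = y.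
Proof. by move=> xy0 xy1 xy2; apply/rowP; exact: ord3P. Qed.

(** A neighbourhood of a row vector contains a product of neighbourhoods of its entries, hence a
    product of three base sets of the line. Such a product pulls back under [mkvec] to a measurable
    rectangle. *)
Lemma countable_base_in_mkvec :
  countable_base_in [set A : set vec | measurable ((@mkvec R : R3 -> vec) @^-1` A)].
Proof.
have [B mB bB] := countable_base_in_real R.
exists (fun n => if @unpickle (nat * nat * nat)%type n is Some k
  then [set x : vec | [/\ B k.1.1 (x 0 o0), B k.1.2 (x 0 o1) & B k.2 (x 0 o2)]]
  else set0) => [n|].
  case: (unpickle n) => [k|] /=; last first.
    by rewrite preimage_set0; exact: measurable0.
  rewrite (_ : _ @^-1` _ = (B k.1.1 `*` B k.1.2) `*` B k.2); last first.
    apply/seteqP; split => p /=; rewrite !mkvecE; first by case.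
    by case=> -[].
  by apply: measurableX => //; exact: measurableX.
move=> x U [P /= xP PU].
have [n0 B0 s0] := bB _ _ (xP 0 o0).
have [n1 B1 s1] := bB _ _ (xP 0 o1).
have [n2 B2 s2] := bB _ _ (xP 0 o2).
exists (pickle (n0, n1, n2)); rewrite pickleK//=.
move=> y [/= y0 y1 y2]; apply: PU => i j; rewrite (ord1 i); move: j.
by apply: ord3P; [exact: s0|exact: s1|exact: s2].
Qed.

Lemma continuous_measurable_mkvec (g : vec -> R) : continuous g ->
  measurable_fun [set: R3] (g \o @mkvec R).
Proof. by apply: continuous_comp_measurable; exact: countable_base_in_mkvec. Qed.

Definition mkvec_pair (z : R3 * R3) : vec * vec := (mkvec z.1, mkvec z.2).

Lemma continuous_measurable_mkvec_pair (g : vec * vec -> R) : continuous g ->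
  measurable_fun [set: R3 * R3] (g \o mkvec_pair).
Proof.
apply: continuous_comp_measurable.
apply: countable_base_in_prod countable_base_in_mkvec countable_base_in_mkvec.
move=> A B mA mB /=.
rewrite (_ : _ @^-1` _ = (@mkvec R @^-1` A) `*` (@mkvec R @^-1` B))//.
exact: measurableX.
Qed.

End mkvec.

(** * Product measures and Fubini on rectangles *)

Section product_sigma_finite.
Local Open Scope ereal_scope.
Context d1 d2 (T1 : measurableType d1) (T2 : measurableType d2) (R : realType).
Variable m1 : {sigma_finite_measure set T1 -> \bar R}.
Variable m2 : {sigma_finite_measure set T2 -> \bar R}.

(* The library registers the product as a sigma-finite measure only when the
   factors are subprobabilities, hence this alias of [m1 \x m2]. *)
Definition mprod : set (T1 * T2) -> \bar R := m1 \x m2.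

HB.instance Definition _ := Measure.copy mprod (m1 \x m2).

Lemma integral_mprod (D : set (T1 * T2)) (f : T1 * T2 -> \bar R) :
  \int[mprod]_(z in D) f z = \int[m1 \x m2]_(z in D) f z.
Proof. by []. Qed.

Lemma mprod_setX (A : set T1) (B : set T2) :
  measurable A -> measurable B -> mprod (A `*` B) = m1 A * m2 B.
Proof. exact: product_measure1E. Qed.

(** The rectangles built from the two exhausting sequences, indexed by pickled pairs, cover the
    product and have finite measure. *)
Lemma mprod_sigma_finite : sigma_finite setT mprod.
Proof.
have [F FT Foo] := sigma_finiteT m1; have [G GT Goo] := sigma_finiteT m2.
exists (fun n => if @unpickle (nat * nat)%type n is Some k
                 then F k.1 `*` G k.2 else set0) => [|n].
  apply/seteqP; split => // -[x y] _.
  have [i _ Fx] : (\bigcup_n F n) x by rewrite -FT.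
  have [j _ Gy] : (\bigcup_n G n) y by rewrite -GT.
  by exists (pickle (i, j)) => //; rewrite pickleK.
case: (unpickle n) => [[i j]|] /=; last by rewrite measure0.
have [[mF Fy] [mG Gy]] := (Foo i, Goo j); split; first exact: measurableX.
by rewrite mprod_setX// lte_mul_pinfty// ge0_fin_numE.
Qed.

HB.instance Definition _ := Measure_isSigmaFinite.Build _ _ _ mprod
  mprod_sigma_finite.

End product_sigma_finite.

Section fubini_rectangle.
Local Open Scope ereal_scope.
Context d1 d2 (T1 : measurableType d1) (T2 : measurableType d2) (R : realType).
Variable m1 : {sigma_finite_measure set T1 -> \bar R}.
Variable m2 : {sigma_finite_measure set T2 -> \bar R}.
Variables (D1 : set T1) (D2 : set T2).
Hypotheses (mD1 : measurable D1) (mD2 : measurable D2).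

Section integrand.
Variable f : T1 * T2 -> \bar R.
Hypothesis intf : (mprod m1 m2).-integrable (D1 `*` D2) f.

(** Extension by zero reduces Fubini on a rectangle to Fubini on the whole product; [patch_setXl]
    and [patch_setXr] then identify the inner integrals. *)
Let intfT : (mprod m1 m2).-integrable setT (f \_ (D1 `*` D2)).
Proof. by apply/(integrable_mkcond _ _).1 => //; exact: measurableX. Qed.

Let patch_setXl x : \int[m2]_y (f \_ (D1 `*` D2)) (x, y) =
  ((fun x => \int[m2]_(y in D2) f (x, y)) \_ D1) x.
Proof.
rewrite /patch; case: ifPn => [xD1|xD1].
  rewrite [RHS]integral_mkcond; apply: eq_integral => y _.
  rewrite /patch; congr (if _ then _ else _).
  by apply/idP/idP; rewrite !inE /=; [case|split=> //; move: xD1; rewrite inE].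
apply: integral0_eq => y _; case: ifPn => //; rewrite inE /= => -[xD _].
by case/negP: xD1; rewrite inE.
Qed.

Let patch_setXr y : \int[m1]_x (f \_ (D1 `*` D2)) (x, y) =
  ((fun y => \int[m1]_(x in D1) f (x, y)) \_ D2) y.
Proof.
rewrite /patch; case: ifPn => [yD2|yD2].
  rewrite [RHS]integral_mkcond; apply: eq_integral => x _.
  rewrite /patch; congr (if _ then _ else _).
  by apply/idP/idP; rewrite !inE /=; [case|split=> //; move: yD2; rewrite inE].
apply: integral0_eq => x _; case: ifPn => //; rewrite inE /= => -[_ yD].
by case/negP: yD2; rewrite inE.
Qed.

Lemma integral_setX12 : \int[mprod m1 m2]_(z in D1 `*` D2) f z =
  \int[m1]_(x in D1) \int[m2]_(y in D2) f (x, y).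
Proof.
rewrite integral_mkcond [RHS]integral_mkcond integral_mprod.
apply: etrans (esym (integral12_prod_meas1 intfT)) _.
by apply: eq_integral => x _; exact: patch_setXl.
Qed.

Lemma integral_setX21 : \int[mprod m1 m2]_(z in D1 `*` D2) f z =
  \int[m2]_(y in D2) \int[m1]_(x in D1) f (x, y).
Proof.
rewrite integral_mkcond [RHS]integral_mkcond integral_mprod.
apply: etrans (esym (integral21_prod_meas1 intfT)) _.
by apply: eq_integral => y _; exact: patch_setXr.
Qed.

Lemma integral_setX12_eq0 :
  (forall x, D1 x -> \int[m2]_(y in D2) f (x, y) = 0) ->
  \int[mprod m1 m2]_(z in D1 `*` D2) f z = 0.
Proof. by move=> f0; rewrite integral_setX12; exact: integral0_eq. Qed.

Lemma integral_setX21_eq0 :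
  (forall y, D2 y -> \int[m1]_(x in D1) f (x, y) = 0) ->
  \int[mprod m1 m2]_(z in D1 `*` D2) f z = 0.
Proof. by move=> f0; rewrite integral_setX21; exact: integral0_eq. Qed.

Lemma integrable_setX12 :
  m1.-integrable D1 (fun x => \int[m2]_(y in D2) f (x, y)).
Proof.
apply/(integrable_mkcond _ _).2 => //.
rewrite (_ : _ \_ _ = fubini_F m2 (f \_ (D1 `*` D2))); last first.
  by apply/funext => x; rewrite /fubini_F patch_setXl.
exact: integrable_fubini_F.
Qed.

End integrand.

(** By Tonelli it is enough that the iterated integral of the absolute value is finite, and for
    nonnegative factors it is the product of two finite integrals. *)
Lemma integrable_setX_mul (g1 : T1 -> R) (g2 : T2 -> R) :
  (forall x, 0 <= g1 x)%R -> (forall y, 0 <= g2 y)%R ->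
  m1.-integrable setT (EFin \o g1) -> m2.-integrable setT (EFin \o g2) ->
  (mprod m1 m2).-integrable setT (fun z => (g1 z.1 * g2 z.2)%:E).
Proof.
move=> g1_ge0 g2_ge0 ig1 ig2.
have mg1 : measurable_fun setT g1 by apply/measurable_EFinP/measurable_int/ig1.
have mg2 : measurable_fun setT g2 by apply/measurable_EFinP/measurable_int/ig2.
apply: (proj2 (@integrable12ltyP _ _ _ _ _ m1 m2 _ _)).
  apply/measurable_EFinP; apply: measurable_funM.
    exact: measurableT_comp.
  exact: measurableT_comp.
have ig2y : \int[m2]_y (g2 y)%:E \is a fin_num by exact: integrable_fin_num.
under eq_integral => x _.
  under eq_integral => y _ do rewrite /= ger0_norm ?mulr_ge0// EFinM.
  rewrite ge0_integralZl//; last 3 first.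
  - exact: measurable_int ig2.
  - by move=> y _; rewrite lee_fin.
  - by rewrite lee_fin.
  rewrite -(fineK ig2y).
  over.
rewrite ge0_integralZr//; last 3 first.
- exact: measurable_int ig1.
- by move=> y _; rewrite lee_fin.
- by rewrite lee_fin fine_ge0// integral_ge0// => y _; rewrite lee_fin.
have /fineK <- : \int[m1]_y (g1 y)%:E \is a fin_num by exact: integrable_fin_num.
by rewrite -EFinM ltry.
Qed.

End fubini_rectangle.

(** * Integration over the periodic box *)

Section lebesgue3.
Variable R : realType.
Local Notation RR := (measurableTypeR R).

(** [leb2] and [leb3] are convertible to the product measures inside [integral3], but carry the
    sigma-finite structure that Fubini asks for. *)
Definition leb2 : {sigma_finite_measure set (RR * RR)%type -> \bar R} :=
  mprod (@lebesgue_measure R) (@lebesgue_measure R).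

Definition leb3 : {sigma_finite_measure set (RR * RR * RR)%type -> \bar R} :=
  mprod leb2 (@lebesgue_measure R).

Lemma integral3E (D : set 'rV[R]_3) (g : 'rV[R]_3 -> R) :
  integral3 D g = Rintegral leb3 (@mkvec R @^-1` D) (g \o @mkvec R).
Proof. by []. Qed.

Lemma leb2_setX (A B : set RR) : measurable A -> measurable B ->
  (leb2 (A `*` B) = lebesgue_measure A * lebesgue_measure B)%E.
Proof. exact: mprod_setX. Qed.

Lemma leb3_setX (A : set (RR * RR)) (B : set RR) :
  measurable A -> measurable B -> (leb3 (A `*` B) = leb2 A * lebesgue_measure B)%E.
Proof. exact: mprod_setX. Qed.

Lemma measurable_mkvec_setT : measurable (@mkvec R @^-1` setT : set (RR * RR * RR)).
Proof. by rewrite preimage_setT; exact: measurableT. Qed.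

End lebesgue3.

Section integral3.
Variables (R : realType) (D : set 'rV[R]_3).
Local Notation RR := (measurableTypeR R).
Hypothesis mD : measurable (@mkvec R @^-1` D : set (RR * RR * RR)).

Definition integrable3 (g : 'rV[R]_3 -> R) :=
  (leb3 R).-integrable (@mkvec R @^-1` D) (EFin \o (g \o @mkvec R)).

Lemma integral3_EFin g : integrable3 g ->
  ((integral3 D g)%:E = \int[leb3 R]_(p in @mkvec R @^-1` D) (g (mkvec p))%:E)%E.
Proof. by move=> gi; rewrite integral3E /Rintegral fineK// integrable_fin_num. Qed.

Lemma integral3D f g : integrable3 f -> integrable3 g ->
  integral3 D (fun x => f x + g x) = integral3 D f + integral3 D g.
Proof. by move=> fi gi; rewrite !integral3E -RintegralD. Qed.

Lemma integral3Zl (c : R) f : integrable3 f ->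
  integral3 D (fun x => c * f x) = c * integral3 D f.
Proof. by move=> fi; rewrite !integral3E -RintegralZl. Qed.

Lemma integrable3Zl (c : R) f : integrable3 f -> integrable3 (fun x => c * f x).
Proof. by move=> fi; exact: (integrableZl mD c fi). Qed.

Lemma integrable3D f g : integrable3 f -> integrable3 g ->
  integrable3 (fun x => f x + g x).
Proof. by move=> fi gi; exact: (integrableD mD fi gi). Qed.

End integral3.

Section box.
Variables (R : realType) (a L : 'rV[R]_3).
Local Notation vec := 'rV[R]_3.
Local Notation RR := (measurableTypeR R).
Local Notation lam := (@lebesgue_measure R).
Local Notation leb2 := (leb2 R).
Local Notation leb3 := (leb3 R).

Definition edge (d : 'I_3) : set RR := `[a 0 d, a 0 d + L 0 d].

Lemma preimage_box :
  @mkvec R @^-1` box a L = (edge o0 `*` edge o1) `*` edge o2.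
Proof.
apply/seteqP; split => p /=.
  move=> pb; move: (pb o0) (pb o1) (pb o2); rewrite !mkvecE => p0 p1 p2.
  by rewrite /edge /= !in_itv /=.
rewrite /edge /= !in_itv /= => -[[p0 p1] p2].
by apply: ord3P; rewrite mkvecE.
Qed.

Lemma measurable_edge d : measurable (edge d).
Proof. exact: measurable_itv. Qed.

Lemma lebesgue_edge_lty d : (lam (edge d) < +oo)%E.
Proof. by rewrite lebesgue_measure_itv /=; case: ifP; rewrite ?ltry// -EFinB ltry. Qed.

Lemma measurable_box : measurable (@mkvec R @^-1` box a L : set (RR * RR * RR)).
Proof.
rewrite preimage_box; apply: measurableX; [apply: measurableX|]; exact: measurable_edge.
Qed.

Lemma measure_edge2_lty d d' : (leb2 (edge d `*` edge d') < +oo)%E.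
Proof.
rewrite leb2_setX; [|exact: measurable_edge|exact: measurable_edge].
apply: lte_mul_pinfty => //; last exact: lebesgue_edge_lty.
by rewrite ge0_fin_numE// lebesgue_edge_lty.
Qed.

Lemma measure_box_lty : (leb3 (@mkvec R @^-1` box a L) < +oo)%E.
Proof.
rewrite preimage_box leb3_setX; last 2 first.
- by apply: measurableX; exact: measurable_edge.
- exact: measurable_edge.
apply: lte_mul_pinfty => //; last exact: lebesgue_edge_lty.
by rewrite ge0_fin_numE// measure_edge2_lty.
Qed.

Lemma compact_box : compact (box a L).
Proof.
rewrite (_ : box a L =
    [set x : vec | forall d, `[a 0 d, a 0 d + L 0 d]%classic (x ord0 d)]).
  by apply: (@rV_compact R 3 (fun d => `[a 0 d, a 0 d + L 0 d]%classic)) => d;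
    exact: segment_compact.
by apply/seteqP; split => x /= xb d; have := xb d; rewrite in_itv.
Qed.

Lemma continuous_bounded_box (g : vec -> R) : continuous g ->
  exists C, forall x, box a L x -> `|g x| <= C.
Proof.
move=> cg.
have /compact_bounded[M [_ MP]] :
    compact (g @` box a L).
  by apply: continuous_compact compact_box; exact: continuous_subspaceT.
exists (M + 1) => x xb; apply: (MP (M + 1)); first by rewrite ltrDl.
by exists x.
Qed.

(** The box is compact, so [g] is bounded on it, and the box has finite measure. *)
Lemma integrable_box (g : vec -> R) : continuous g ->
  leb3.-integrable (@mkvec R @^-1` box a L) (EFin \o (g \o @mkvec R)).
Proof.
move=> cg; apply: measurable_bounded_integrable.
- exact: measurable_box.
- exact: measure_box_lty.
- by apply: measurable_funTS; exact: continuous_measurable_mkvec.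
- have [C CP] := continuous_bounded_box cg.
  exists C; split; first exact: num_real.
  by move=> r Cr p /= /CP gp; rewrite (le_trans gp)// ltW.
Qed.

End box.

(** * Partial derivatives of periodic functions integrate to zero *)

Section periodic.
Variable R : realType.
Local Notation vec := 'rV[R]_3.
Local Notation RR := (measurableTypeR R).
Local Notation lam := (@lebesgue_measure R).
Local Notation leb2 := (leb2 R).
Local Notation leb3 := (leb3 R).

Lemma continuous_line (e x : vec) : continuous (fun t : R => t *: e + x).
Proof.
by move=> t; apply: cvgD; [apply: cvgZr_tmp; exact: cvg_id|exact: cvg_cst].
Qed.

(** The quotients agree as functions of [h], so derivability and the derivative pass from the axis
    direction to the restriction to a line without a chain rule. *)
Lemma difference_quotient_line (d : 'I_3) (g : vec -> R) (x : vec) (t : R) :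
  (fun h : R => h^-1 *:
    (((fun s : R => g (s *: unitv R d + x)) \o shift t) (h *: (1 : R))
     - g (t *: unitv R d + x))) =
  (fun h : R => h^-1 *: ((g \o shift (t *: unitv R d + x)) (h *: unitv R d)
     - g (t *: unitv R d + x))).
Proof.
apply/funext => h /=; congr (_ *: (g _ - _)).
by rewrite -[h *: 1]/(h * 1) mulr1 scalerDl addrA.
Qed.

Lemma derivable_line (d : 'I_3) (g : vec -> R) (x : vec) (t : R) :
  derivable g (t *: unitv R d + x) (unitv R d) ->
  derivable (fun s : R => g (s *: unitv R d + x)) t 1.
Proof. by rewrite /derivable difference_quotient_line. Qed.

Lemma derive1_line (d : 'I_3) (g : vec -> R) (x : vec) (t : R) :
  (fun s : R => g (s *: unitv R d + x))^`() t = partial d g (t *: unitv R d + x).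
Proof. by rewrite derive1E /partial /derive difference_quotient_line. Qed.

Variables a L : vec.
Hypothesis L_gt0 : forall d, 0 < L 0 d.
Variables (d : 'I_3) (g : vec -> R).
Hypotheses (dg : forall x, derivable g x (unitv R d))
  (cpg : continuous (partial d g)) (pg : Defs.periodic L g).

(** By the fundamental theorem of calculus this is the difference of the values of [g] at the two
    ends of a segment of length [L 0 d] in direction [d], which are equal by periodicity. *)
Lemma integral_partial_line (x : vec) :
  (\int[lam]_(t in edge a L d) (partial d g (t *: unitv R d + x))%:E = 0)%E.
Proof.
pose phi t := g (t *: unitv R d + x).
have dphi t : derivable phi t 1 by exact: derivable_line.
have cphi : continuous phi.
  by move=> t; apply/differentiable_continuous/derivable1_diffP.
rewrite (@continuous_FTC2 _ _ phi).
- by rewrite /phi scalerDl addrAC pg subee.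
- by rewrite ltrDl.
- apply: continuous_subspaceT => t.
  apply: continuous_comp; first exact: continuous_line.
  exact: cpg.
- split; first by move=> t _; exact: dphi.
  + by apply: cvg_at_right_filter; exact: cphi.
  + by apply: cvg_at_left_filter; exact: cphi.
- by move=> t _; rewrite derive1_line.
Qed.

Lemma integrable_slice (h : vec -> R) (z : R) : continuous h -> edge a L o2 z ->
  leb2.-integrable (edge a L o0 `*` edge a L o1)
    (fun p => (h (mkvec (p, z)))%:E).
Proof.
move=> ch zL; apply: measurable_bounded_integrable.
- by apply: measurableX; exact: measurable_edge.
- exact: measure_edge2_lty.
- apply: measurable_funTS.
  by apply: (measurableT_comp (continuous_measurable_mkvec ch)); exact: measurable_pair2.
- have [C CP] := continuous_bounded_box a L ch.
  exists C; split; first exact: num_real.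
  move=> r Cr p /= [p0 p1]; rewrite (le_trans _ (ltW Cr))//; apply: CP.
  have : (@mkvec R @^-1` box a L) (p, z) by rewrite preimage_box.
  by [].
Qed.

Lemma integral3_partial_periodic : integral3 (box a L) (partial d g) = 0.
Proof.
rewrite integral3E /Rintegral; suff -> : (\int[leb3]_(p in @mkvec R @^-1` box a L)
  ((partial d g \o @mkvec R) p)%:E = 0)%E by [].
have ib := integrable_box a L cpg; move: integral_partial_line ib.
rewrite preimage_box; have mE := @measurable_edge R a L.
have mE2 := measurableX (mE o0) (mE o1).
have is2 := @integrable_slice _ _ cpg.
(* The direction [d] decides the order of integration: in each case Fubini moves the coordinate [d]
   innermost, where the line integral vanishes. *)
move: (d) (is2); apply: ord3P => {}is2 il ib.
- apply: (integral_setX21_eq0 mE2 (mE _) ib) => z zL.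
  apply: (integral_setX21_eq0 (mE _) (mE _) (is2 _ zL)) => y _.
  (* The base point has 0 in the slot of integration, so adding [x] times the unit vector gives
     exactly the point with coordinates [x], [y], [z]. *)
  rewrite -[RHS](il (mkvec (0, y, z))); apply: eq_integral => x _ /=.
  by congr (partial _ _ _)%:E; apply: rV3P;
     rewrite !mxE/= ?mulr1 ?mulr0 ?addr0 ?add0r.
- apply: (integral_setX21_eq0 mE2 (mE _) ib) => z zL.
  apply: (integral_setX12_eq0 (mE _) (mE _) (is2 _ zL)) => x _.
  rewrite -[RHS](il (mkvec (x, 0, z))); apply: eq_integral => y _ /=.
  by congr (partial _ _ _)%:E; apply: rV3P;
     rewrite !mxE/= ?mulr1 ?mulr0 ?addr0 ?add0r.
- apply: (integral_setX12_eq0 mE2 (mE _) ib) => p _.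
  rewrite -[RHS](il (mkvec (p, 0))); apply: eq_integral => z _ /=.
  by congr (partial _ _ _)%:E; apply: rV3P;
     rewrite !mxE/= ?mulr1 ?mulr0 ?addr0 ?add0r.
Qed.

End periodic.

(** * Rapidly decaying integrands *)

Section weight.
Variable R : realType.
Local Notation RR := (measurableTypeR R).
Local Notation lam := (@lebesgue_measure R).

Lemma oneDsqrV_ge0 (x : R) : 0 <= (oneDsqr x)^-1.
Proof. by rewrite invr_ge0 (le_trans _ (oneDsqr_ge1 x)). Qed.

(** The integrand is even, so its integral is twice the known finite integral over the half-line. *)
Lemma integrable_oneDsqrV :
  lam.-integrable setT (EFin \o (fun x : R => (oneDsqr x)^-1)).
Proof.
apply/integrableP; split.
  apply/measurable_EFinP; apply: continuous_measurable_fun.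
  exact: continuous_oneDsqrV.
under eq_integral => x _ do rewrite /= ger0_norm ?oneDsqrV_ge0//.
rewrite (@ge0_symfun_integralT _ (fun x : R => (oneDsqr x)^-1)).
- by rewrite -set_itvcy integral0y_oneDsqr -EFinM ltry.
- exact: oneDsqrV_ge0.
- exact: continuous_oneDsqrV.
- by move=> x /=; rewrite /oneDsqr sqrrN.
Qed.

(* The integrable majorant of the rapidly decaying functions of v. *)
Definition weight3 (p : RR * RR * RR) : R :=
  (oneDsqr p.1.1)^-1 * (oneDsqr p.1.2)^-1 * (oneDsqr p.2)^-1.

Lemma weight3_ge0 p : 0 <= weight3 p.
Proof. by rewrite !mulr_ge0// oneDsqrV_ge0. Qed.

Lemma integrable_weight3 : (leb3 R).-integrable setT (EFin \o weight3).
Proof.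
have w_ge0 (x : RR) : 0 <= (fun t : RR => (@oneDsqr R t)^-1) x := oneDsqrV_ge0 x.
have i1 := integrable_oneDsqrV.
have i2 := integrable_setX_mul w_ge0 w_ge0 i1 i1.
by apply: (integrable_setX_mul _ w_ge0 i2 i1) => p; rewrite mulr_ge0.
Qed.

Lemma coord_le_norm (v : 'rV[R]_3) d : `|v 0 d| <= `|v|.
Proof.
rewrite [leRHS]/Num.norm /= mx_normrE.
by apply: (le_bigmax _ (fun ij : 'I_1 * 'I_3 => `|v ij.1 ij.2|) (0, d)).
Qed.

(** Each coordinate is at most the norm, so each of the three factors [oneDsqr] is at most the
    square of one plus the norm; together they give the exponent 6. *)
Lemma weight3_decay p : 1 <= weight3 p * (1 + `|mkvec p|) ^+ 6.
Proof.
have sq d : oneDsqr (mkvec p 0 d) <= (1 + `|mkvec p|) ^+ 2.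
  rewrite /oneDsqr -real_normK ?num_real// sqrrD expr1n mul1r -addrA lerD2l.
  by rewrite ler_wpDl ?mulrn_wge0// lerXn2r// ?nnegrE// coord_le_norm.
have gt0 x : 0 < @oneDsqr R x by rewrite (lt_le_trans _ (oneDsqr_ge1 x)).
rewrite /weight3 -!invfM mulrC ler_pdivlMr ?mulr_gt0// mul1r.
rewrite (_ : 6 = 2 + 2 + 2)%N// !exprD.
have := sq o0; have := sq o1; have := sq o2; rewrite !mkvecE => s2 s1 s0.
by rewrite !ler_pM ?mulr_ge0// ?ltW.
Qed.

End weight.

Section decaying.
Variable R : realType.
Local Notation vec := 'rV[R]_3.
Local Notation RR := (measurableTypeR R).

(** A class of integrands shared by [f] and its space derivatives and stable under multiplication by
    polynomials in the velocity. Continuity is joint in both variables, for measurability on phase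
    space. *)
Definition decaying (G : vec -> vec -> R) : Prop :=
  continuous (fun z : vec * vec => G z.1 z.2) /\ rapid_decay G.

Lemma decaying_mul_coord d G :
  decaying G -> decaying (fun x v => v 0 d * G x v).
Proof.
move=> [cG dG]; split=> [z|k].
  apply: (@continuousM _ _ (fun z : vec * vec => z.2 0 d)); last exact: cG.
  apply: (@continuous_comp _ _ _ snd (fun v : vec => v 0 d)); first exact: cvg_snd.
  exact: coord_continuous.
(* The factor [v 0 d] is absorbed by one additional power of the decay weight. *)
have [C CP] := dG k.+1; exists C => x v; apply: le_trans (CP x v).
rewrite exprSr -mulrA ler_wpM2l ?exprn_ge0 ?addr_ge0// normrM ler_wpM2r//.
by rewrite (le_trans (coord_le_norm _ _))// lerDr.
Qed.

Lemma decayingD G H :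
  decaying G -> decaying H -> decaying (fun x v => G x v + H x v).
Proof.
move=> [cG dG] [cH dH]; split=> [z|k].
  by apply: continuousD; [exact: cG|exact: cH].
have [C CP] := dG k; have [D DP] := dH k; exists (C + D) => x v.
apply: le_trans (lerD (CP x v) (DP x v)).
by rewrite -mulrDr ler_wpM2l ?exprn_ge0 ?addr_ge0// ler_normD.
Qed.

Lemma decaying_sqnorm G : decaying G -> decaying (fun x v => sqnorm v * G x v).
Proof.
move=> dG; rewrite (_ : (fun _ _ => _) = fun x v : vec => v 0 o0 * (v 0 o0 * G x v)
  + v 0 o1 * (v 0 o1 * G x v) + v 0 o2 * (v 0 o2 * G x v)).
  by do 2 ?apply: decayingD; do 2 apply: decaying_mul_coord.
by apply/funext => x; apply/funext => v; rewrite /sqnorm sum3E; ring.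
Qed.

Lemma decaying_continuousr G x : decaying G -> continuous (G x).
Proof.
move=> [cG _] v.
apply: (@continuous_comp _ _ _ (fun v : vec => (x, v))
  (fun z : vec * vec => G z.1 z.2)).
  by apply: (@cvg_pair _ _ _ (nbhs v) (nbhs x) (nbhs v)); [exact: cvg_cst|exact: cvg_id].
exact: (cG (x, v)).
Qed.

Lemma decaying_continuousl G v : decaying G -> continuous (G^~ v).
Proof.
move=> [cG _] x.
apply: (@continuous_comp _ _ _ (fun x : vec => (x, v))
  (fun z : vec * vec => G z.1 z.2)).
  by apply: (@cvg_pair _ _ _ (nbhs x) (nbhs x) (nbhs v)); [exact: cvg_id|exact: cvg_cst].
exact: (cG (x, v)).
Qed.

Lemma decaying_bound G : decaying G ->
  exists2 C, 0 <= C & forall x p, `|G x (mkvec p)| <= C * weight3 p.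
Proof.
(* Decay of order 6 matches [weight3_decay]; the constant is uniform in [x]. *)
move=> [_ dG]; have [C CP] := dG 6%N; exists `|C| => // x p.
apply: (@le_trans _ _ (weight3 p * (1 + `|mkvec p|) ^+ 6 * `|G x (mkvec p)|)).
  by rewrite ler_peMl// weight3_decay.
rewrite -mulrA mulrC ler_wpM2r ?weight3_ge0//.
by rewrite (le_trans (CP x (mkvec p)))// ler_norm.
Qed.

Lemma decaying_integrable G x : decaying G -> integrable3 setT (G x).
Proof.
rewrite /integrable3 preimage_setT => dG; have [C C0 CP] := decaying_bound dG.
apply: (le_integrable _ _ _ (integrableZl _ C (@integrable_weight3 R))) => //.
  apply/measurable_EFinP; apply: continuous_measurable_mkvec.
  exact: decaying_continuousr.
by move=> p _; rewrite lee_fin (le_trans (CP x p))// ler_norm.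
Qed.

Variables a L : vec.

(** The majorant is [C] times the indicator of the box in [x] times [weight3] in [v], a product of
    two integrable functions of separate variables. *)
Lemma decaying_integrable_box_setT G : decaying G ->
  (mprod (leb3 R) (leb3 R)).-integrable ((@mkvec R @^-1` box a L) `*` setT)
    (fun z => (G (mkvec z.1) (mkvec z.2))%:E).
Proof.
move=> dG; have [C C0 CP] := decaying_bound dG; have [cG _] := dG.
have mB := @measurable_box R a L.
have mBT := measurableX mB (@measurableT _ (RR * RR * RR)%type).
have iB : (leb3 R).-integrable setT (EFin \o (\1_(@mkvec R @^-1` box a L) : _ -> R)).
  have := (integrable_mkcond _ mB).1 (integrable_box a L (@cst_continuous vec R 1)).
  rewrite (_ : _ \_ _ = EFin \o \1_(@mkvec R @^-1` box a L))//.
  by apply/funext => z; rewrite /patch /= indicE; case: ifP.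
have ind0 (z : RR * RR * RR) : 0 <= (\1_(@mkvec R @^-1` box a L) z : R) by rewrite indicE.
have iw := integrable_setX_mul ind0 (@weight3_ge0 R) iB (@integrable_weight3 R).
have {}iw := integrableS measurableT mBT (@subsetT _ _) iw.
apply: (le_integrable mBT _ _ (integrableZl mBT C iw)).
  apply/measurable_EFinP; apply: measurable_funTS.
  exact: (@continuous_measurable_mkvec_pair _ (fun z => G z.1 z.2)).
move=> [x v] [/= xB _]; rewrite lee_fin indicE mem_set// mul1r.
by rewrite (le_trans (CP _ _))// ler_norm.
Qed.

Lemma decaying_integral_EFin G x : decaying G ->
  ((integral3 setT (G x))%:E = \int[leb3 R]_p (G x (mkvec p))%:E)%E.
Proof.
move=> /(decaying_integrable x)/integral3_EFin -> //.
exact: measurable_mkvec_setT.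
Qed.

Lemma decaying_integrable_box G : decaying G ->
  integrable3 (box a L) (fun x => integral3 setT (G x)).
Proof.
move=> dG; have iG := decaying_integrable_box_setT dG.
have mB := @measurable_box R a L.
apply: eq_integrable (integrable_setX12 mB measurableT iG) => // x _ /=.
by rewrite decaying_integral_EFin.
Qed.

Lemma decaying_Fubini G : decaying G ->
  integral3 (box a L) (fun x => integral3 setT (G x)) =
  integral3 setT (fun v => integral3 (box a L) (G^~ v)).
Proof.
move=> dG; have iG := decaying_integrable_box_setT dG.
have mB := @measurable_box R a L.
suff E : (\int[leb3 R]_(x in @mkvec R @^-1` box a L)
      (* [integral3] is real-valued, so Fubini is proved between extended reals, and [fine] is
         applied at the end. *)
      (integral3 setT (G (mkvec x)))%:E =
    \int[leb3 R]_(v in @mkvec R @^-1` setT)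
      (integral3 (box a L) (G^~ (mkvec v)))%:E)%E.
  exact: (congr1 fine E).
transitivity (\int[leb3 R]_(x in @mkvec R @^-1` box a L)
    \int[leb3 R]_v (G (mkvec x) (mkvec v))%:E)%E.
  by apply: eq_integral => x _; exact: decaying_integral_EFin.
apply: etrans (esym (integral_setX12 mB measurableT iG)) _.
apply: etrans (integral_setX21 mB measurableT iG) _.
rewrite preimage_setT; apply: eq_integral => v _; apply: esym.
apply: (integral3_EFin mB); apply: integrable_box.
exact: decaying_continuousl.
Qed.

End decaying.

(** * Free transport *)

Section transport.
Variables (R : realType) (a L : 'rV[R]_3).
Hypothesis L_gt0 : forall d, 0 < L 0 d.
Local Notation vec := 'rV[R]_3.

Lemma integral3_eq0 (D : set vec) (g : vec -> R) :
  (forall x, g x = 0) -> integral3 D g = 0.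
Proof.
move=> g0; rewrite integral3E /Rintegral integral0_eq// => p _ /=.
by rewrite g0.
Qed.

Variable f : vec -> vec -> R.
Hypothesis rf : regular_distribution L f.

Lemma regular_decaying : decaying f.
Proof. by case: rf => smf _ df _; split=> //; case: (smf 0%N). Qed.

(** A space derivative of [f] is a derivative on phase space in a direction with zero velocity part.
    Smoothness in both variables thus yields joint continuity of the space derivatives. *)
Lemma difference_quotient_fst (d : 'I_3) (x v : vec) :
  (fun h : R => h^-1 *: (((fun z : vec * vec => f z.1 z.2) \o shift (x, v))
     (h *: (unitv R d, 0 : vec)) - f x v)) =
  (fun h : R => h^-1 *: ((f^~ v \o shift x) (h *: unitv R d) - f x v)).
Proof. by apply/funext => h /=; rewrite scaler0 add0r. Qed.

Lemma regular_derivable d v x : derivable (f^~ v) x (unitv R d).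
Proof.
have [smf _ _ _] := rf; have [_ /(_ (unitv R d, 0)) [+ _]] := smf 1%N.
by move=> /(_ (x, v)); rewrite /derivable difference_quotient_fst.
Qed.

Lemma regular_partial_decaying d :
  decaying (fun x v => partial d (f^~ v) x).
Proof.
have [smf _ _ /(_ d) df] := rf; split=> //.
have [_ /(_ (unitv R d, 0)) [_ [+ _]]] := smf 1%N.
rewrite (_ : (fun z => 'D__ _ z) = fun z => partial d (f^~ z.2) z.1)//.
apply/funext => -[x v] /=.
by rewrite /partial /derive difference_quotient_fst.
Qed.

(** The share of direction [d] in the free transport term, weighted by the squared speed. *)
Definition transport_flux d (x v : vec) : R :=
  v 0 d * (sqnorm v * partial d (f^~ v) x).

Lemma transport_flux_decaying d : decaying (transport_flux d).
Proof.
exact/decaying_mul_coord/decaying_sqnorm/regular_partial_decaying.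
Qed.

(** After exchanging the integrals, the velocity factor is constant over the box and leaves the
    integral of a partial derivative of a periodic function. *)
Lemma integral_transport_flux d :
  integral3 (box a L) (fun x => integral3 setT (transport_flux d x)) = 0.
Proof.
rewrite decaying_Fubini; last exact: transport_flux_decaying.
apply: integral3_eq0 => v; rewrite /transport_flux.
have cp := decaying_continuousl (v := v) (regular_partial_decaying d).
under [X in integral3 _ X]funext => x do rewrite mulrA.
rewrite integral3Zl//; last by exact: integrable_box.
  rewrite (integral3_partial_periodic a L_gt0) ?mulr0//.
  - exact: regular_derivable.
  - by have [_ pf _ _] := rf => i x /=; rewrite pf.
exact: measurable_box.
Qed.

End transport.

Section kinetic_energy.
Variables (R : realType) (a L : 'rV[R]_3).
Hypothesis L_gt0 : forall d, 0 < L 0 d.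
Local Notation vec := 'rV[R]_3.

(** Twice the kinetic energy density, thermal part included. *)
Definition kinetic (f : vec -> vec -> R) (x : vec) : R :=
  integral3 setT (fun v => sqnorm v * f x v).

Lemma integrable_kinetic f : regular_distribution L f ->
  integrable3 (box a L) (kinetic f).
Proof.
by move=> rf; apply: decaying_integrable_box; exact/decaying_sqnorm/(regular_decaying rf).
Qed.

(** Solving the transport step for [g] writes its second moment as that of [f] minus [dt] times
    three transport terms, each with zero integral over the box. *)
Lemma kinetic_transport (dt : R) (f g : vec -> vec -> R) :
  dt != 0 -> regular_distribution L f ->
  (forall x v, (g x v - f x v) / dt = - \sum_d v 0 d * partial d (f^~ v) x) ->
  integral3 (box a L) (kinetic g) = integral3 (box a L) (kinetic f).
Proof.
move=> dt0 rf gf.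
have gE x v : sqnorm v * g x v = sqnorm v * f x v + - dt *
    (transport_flux f o0 x v + transport_flux f o1 x v + transport_flux f o2 x v).
  have : g x v = f x v + dt * ((g x v - f x v) / dt) by field.
  rewrite gf sum3E /transport_flux => ->.
  by move: (partial o0 _ x) (partial o1 _ x) (partial o2 _ x) => p0 p1 p2; ring.
have df := decaying_sqnorm (regular_decaying rf).
have d0 := transport_flux_decaying rf o0.
have d1 := transport_flux_decaying rf o1.
have d2 := transport_flux_decaying rf o2.
have mT := @measurable_mkvec_setT R; have mB := @measurable_box R a L.
have kE x : kinetic g x = kinetic f x + - dt *
    (integral3 setT (transport_flux f o0 x) + integral3 setT (transport_flux f o1 x)
      + integral3 setT (transport_flux f o2 x)).
  rewrite /kinetic (funext (gE x)).
  have k0 := decaying_integrable x d0; have k1 := decaying_integrable x d1.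
  have k2 := decaying_integrable x d2; have kf := decaying_integrable x df.
  have k01 := integrable3D mT k0 k1; have ks := integrable3D mT k01 k2.
  have kZ := integrable3Zl mT (- dt) ks.
  rewrite (integral3D mT kf kZ) (integral3Zl mT _ ks) (integral3D mT k01 k2).
  by rewrite (integral3D mT k0 k1).
rewrite (funext kE).
have j3 G : decaying G -> integrable3 (box a L) (fun x => integral3 setT (G x)).
  exact: decaying_integrable_box.
have j0 := j3 _ d0; have j1 := j3 _ d1; have j2 := j3 _ d2.
have j01 := integrable3D mB j0 j1; have js := integrable3D mB j01 j2.
have jf := integrable_kinetic rf; have jZ := integrable3Zl mB (- dt) js.
rewrite (integral3D mB jf jZ) (integral3Zl mB _ js) (integral3D mB j01 j2).
rewrite (integral3D mB j0 j1); move: (integral3 _ (kinetic f)) => K.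
have E (A B C : R) : A = 0 -> B = 0 -> C = 0 -> K + - dt * (A + B + C) = K.
  by move=> -> -> ->; ring.
by apply: E; exact: integral_transport_flux.
Qed.

End kinetic_energy.

(** * Maxwell equations *)

Section fields.
Variables (R : realType) (a L : 'rV[R]_3).
Hypothesis L_gt0 : forall d, 0 < L 0 d.
Local Notation vec := 'rV[R]_3.

Definition C1 (g : vec -> R) : Prop :=
  [/\ continuous g, forall d x, derivable g x (unitv R d) &
      forall d, continuous (partial d g)].

Lemma smooth_C1 g : smooth g -> C1 g.
Proof.
move=> /(_ 1%N)[cg dg]; split=> // d; first by move=> x; have [] := dg (unitv R d).
by have [_ []] := dg (unitv R d).
Qed.

Lemma C1D f g : C1 f -> C1 g -> C1 (f + g).
Proof.
move=> [cf df cpf] [cg dg cpg]; split=> [x|d x|d].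
- exact: continuousD (cf x) (cg x).
- exact: derivableD.
- rewrite (_ : partial d (f + g) = partial d f + partial d g).
    by move=> x; exact: continuousD (cpf d x) (cpg d x).
  by apply/funext => x; rewrite /partial deriveD.
Qed.

Lemma C1B f g : C1 f -> C1 g -> C1 (f - g).
Proof.
move=> [cf df cpf] [cg dg cpg]; split=> [x|d x|d].
- exact: continuousB (cf x) (cg x).
- exact: derivableB.
- rewrite (_ : partial d (f - g) = partial d f - partial d g).
    by move=> x; exact: continuousB (cpf d x) (cpg d x).
  by apply/funext => x; rewrite /partial deriveB.
Qed.

Lemma C1Z (c : R) f : C1 f -> C1 (c \*: f).
Proof.
move=> [cf df cpf]; split=> [x|d x|d].
- exact: continuousM (@cst_continuous _ _ c x) (cf x).
- exact: derivableZ.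
- rewrite (_ : partial d (c \*: f) = cst c * partial d f).
    by move=> x; exact: continuousM (@cst_continuous _ _ c x) (cpf d x).
  by apply/funext => x; rewrite /partial deriveZ.
Qed.

Lemma C1M f g : C1 f -> C1 g -> C1 (f * g).
Proof.
move=> [cf df cpf] [cg dg cpg]; split=> [x|d x|d].
- exact: continuousM (cf x) (cg x).
- exact: derivableM.
- rewrite (_ : partial d (f * g) = f * partial d g + g * partial d f).
    move=> x; apply: continuousD.
      exact: continuousM (cf x) (cpg d x).
    exact: continuousM (cg x) (cpf d x).
  by apply/funext => x; rewrite /partial deriveM.
Qed.

Lemma partialM d f g x : C1 f -> C1 g ->
  partial d (f * g) x = f x * partial d g x + g x * partial d f x.
Proof. by move=> [_ df _] [_ dg _]; rewrite /partial deriveM. Qed.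

Lemma partialB d f g x : C1 f -> C1 g ->
  partial d (f - g) x = partial d f x - partial d g x.
Proof. by move=> [_ df _] [_ dg _]; rewrite /partial deriveB. Qed.

Definition C1_field (F : vec -> vec) : Prop :=
  (forall d, C1 (fun x => F x 0 d)) /\ Defs.periodic L F.

Lemma regular_C1_field F : regular_field L F -> C1_field F.
Proof. by move=> [sF pF]; split=> // d; exact: smooth_C1. Qed.

Lemma midpoint_C1_field F G : C1_field F -> C1_field G ->
  C1_field (fun x => midpoint (F x) (G x)).
Proof.
move=> [dF pF] [dG pG]; split=> [d|d x]; last by rewrite pF pG.
rewrite (_ : (fun _ => _) = 2^-1 \*: ((fun x => F x 0 d) + (fun x => G x 0 d))).
  by apply: C1Z; exact: C1D.
by apply/funext => x; rewrite !mxE.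
Qed.

Definition dot (x y : vec) : R := x 0 o0 * y 0 o0 + x 0 o1 * y 0 o1 + x 0 o2 * y 0 o2.

Lemma levi_civita_sum (G : 'I_3 -> 'I_3 -> R) :
  let S d := \sum_l \sum_m levi_civita R d l m * G l m in
  [/\ S o0 = G o1 o2 - G o2 o1, S o1 = G o2 o0 - G o0 o2 &
      S o2 = G o0 o1 - G o1 o0].
Proof. by split; rewrite !sum3E /levi_civita /=; ring. Qed.

Lemma curlE (F : vec -> vec) x :
  let p l m := partial l (fun y => F y 0 m) x in
  [/\ curl F x 0 o0 = p o1 o2 - p o2 o1, curl F x 0 o1 = p o2 o0 - p o0 o2 &
      curl F x 0 o2 = p o0 o1 - p o1 o0].
Proof.
have [s0 s1 s2] := levi_civita_sum (fun l m => partial l (fun y => F y 0 m) x).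
by split; rewrite mxE.
Qed.

Lemma crossE (x y : vec) :
  [/\ cross x y 0 o0 = x 0 o1 * y 0 o2 - x 0 o2 * y 0 o1,
      cross x y 0 o1 = x 0 o2 * y 0 o0 - x 0 o0 * y 0 o2 &
      cross x y 0 o2 = x 0 o0 * y 0 o1 - x 0 o1 * y 0 o0].
Proof.
have [s0 s1 s2] := levi_civita_sum (fun l m => x 0 l * y 0 m).
split; rewrite mxE; [rewrite -s0|rewrite -s1|rewrite -s2];
  by apply: eq_bigr => l _; apply: eq_bigr => m _; rewrite mulrA.
Qed.

(** The magnetic force does no work. *)
Lemma dot_cross x y : dot x (cross x y) = 0.
Proof. by have [c0 c1 c2] := crossE x y; rewrite /dot c0 c1 c2; ring. Qed.

Lemma continuous_sqnorm F : C1_field F -> continuous (fun x => sqnorm (F x)).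
Proof.
move=> [dF _]; rewrite (_ : (fun _ => _) = (fun x => F x 0 o0) * (fun x => F x 0 o0)
  + (fun x => F x 0 o1) * (fun x => F x 0 o1) + (fun x => F x 0 o2) * (fun x => F x 0 o2)).
  by have [] := C1D (C1D (C1M (dF o0) (dF o0)) (C1M (dF o1) (dF o1))) (C1M (dF o2) (dF o2)).
by apply/funext => x; rewrite /sqnorm sum3E !expr2.
Qed.

(** For [F] electric and [G] magnetic this is minus the divergence of the Poynting vector, the cross
    product of [F] and [G]. *)
Definition poynting (F G : vec -> vec) (x : vec) : R :=
  dot (F x) (curl G x) - dot (G x) (curl F x).

Lemma integral_poynting F G : C1_field F -> C1_field G ->
  integrable3 (box a L) (poynting F G) /\ integral3 (box a L) (poynting F G) = 0.
Proof.
move=> [dF pF] [dG pG].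
(* For cyclic index pairs these are the components of the cross product of [G] and [F], whose
   divergence is [poynting F G]. *)
pose P i j x := G x 0 i * F x 0 j - G x 0 j * F x 0 i.
have CP i j : C1 (P i j).
  by apply: (@C1B ((fun x => G x 0 i) * (fun x => F x 0 j))); exact: C1M.
have PE d i j x : partial d (P i j) x =
    G x 0 i * partial d (fun y => F y 0 j) x + F x 0 j * partial d (fun y => G y 0 i) x
    - (G x 0 j * partial d (fun y => F y 0 i) x + F x 0 i * partial d (fun y => G y 0 j) x).
  by rewrite -!partialM// -partialB//; exact: C1M.
(* The divergence identity for a cross product, with the partial derivatives of [F] and [G] replaced
   by free variables [p] and [q] so that it becomes polynomial. *)
have div_cross (p q : 'I_3 -> 'I_3 -> R) (v w : vec) :
    let D d i j := w 0 i * p d j + v 0 j * q d i - (w 0 j * p d i + v 0 i * q d j) in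
    v 0 o0 * (q o1 o2 - q o2 o1) + v 0 o1 * (q o2 o0 - q o0 o2)
      + v 0 o2 * (q o0 o1 - q o1 o0)
    - (w 0 o0 * (p o1 o2 - p o2 o1) + w 0 o1 * (p o2 o0 - p o0 o2)
      + w 0 o2 * (p o0 o1 - p o1 o0))
    = D o0 o1 o2 + D o1 o2 o0 + D o2 o0 o1.
  by rewrite /=; ring.
have perP i j : Defs.periodic L (P i j) by move=> d x; rewrite /P pF pG.
have iP d i j : integrable3 (box a L) (partial d (P i j)).
  by apply: integrable_box; have [_ _] := CP i j.
have zP d i j : integral3 (box a L) (partial d (P i j)) = 0.
  by apply: integral3_partial_periodic => //; have [_ + +] := CP i j; move=> /(_ d).
have mB := @measurable_box R a L.
rewrite (_ : poynting F G = fun x =>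
    partial o0 (P o1 o2) x + partial o1 (P o2 o0) x + partial o2 (P o0 o1) x).
  have i01 := integrable3D mB (iP o0 o1 o2) (iP o1 o2 o0).
  split; first exact: (integrable3D mB i01 (iP o2 o0 o1)).
  rewrite (integral3D mB i01 (iP o2 o0 o1)) (integral3D mB (iP o0 o1 o2) (iP o1 o2 o0)).
  by rewrite !zP !addr0.
apply/funext => x; rewrite !PE /poynting /dot.
have [-> -> ->] := curlE F x; have [-> -> ->] := curlE G x.
exact: (div_cross (fun l m => partial l (fun y => F y 0 m) x)
                  (fun l m => partial l (fun y => G y 0 m) x) (F x) (G x)).
Qed.

End fields.

(** * Velocity moments and the algebra of one coordinate *)

Section step.
Variables (R : realType) (L : 'rV[R]_3).
Local Notation vec := 'rV[R]_3.

(** Twice the defining relation of the temperature; it links the energy of the theorem to a velocity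
    moment, on which transport acts linearly. *)
Lemma macroscopic_kinetic f rho (u : vec -> vec) T x : macroscopic f rho u T ->
  rho x * (sqnorm (u x) + 3 * T x) = kinetic f x.
Proof. by move=> /(_ x)[_ _ _ _]; rewrite /kinetic => E; lra. Qed.

Lemma macroscopic_current fs f rhos (us : vec -> vec) Ts rho (u : vec -> vec) T x d :
  regular_distribution L fs -> regular_distribution L f ->
  macroscopic fs rhos us Ts -> macroscopic f rho u T ->
  current fs f x 0 d = (rhos x * us x 0 d + rho x * u x 0 d) / 2.
Proof.
move=> rs rf /(_ x)[_ _ _ ms _] /(_ x)[_ _ _ mf _].
have mT := @measurable_mkvec_setT R.
have moment g : regular_distribution L g ->
    integrable3 setT (fun v => v 0 d * g x v).
  by move=> /regular_decaying/(decaying_mul_coord d)/(decaying_integrable x).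
have momentE g r (w : vec) : r *: w = integral3_vec setT (fun v => g x v *: v) ->
    integral3 setT (fun v => v 0 d * g x v) = r * w 0 d.
  move=> /rowP/(_ d); rewrite !mxE => ->; congr integral3.
  by apply/funext => v; rewrite mxE mulrC.
rewrite mxE -(momentE _ _ _ ms) -(momentE _ _ _ mf).
have is1 := moment _ rs; have if1 := moment _ rf.
rewrite mulrC -(integral3D mT is1 if1) -(integral3Zl mT _ (integrable3D mT is1 if1)).
by congr integral3; apply/funext => v; rewrite mxE; field.
Qed.

(** Each difference of squares is the sum times the increment, and the sum is twice the midpoint of
    the scheme. The work of the mean electric field on the mean current then appears in the velocity
    and the field parts with opposite signs and cancels. Here [k] is a component of the magnetic
    force. *)
Lemma component_balance (dt r us u1 E0 E1 B0 B1 cE cB k : R) :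
  u1 - us = dt * ((E0 + E1) / 2 + k) -> E1 - E0 = dt * (cB - r * ((us + u1) / 2)) ->
  B1 - B0 = - (dt * cE) ->
  r * u1 ^+ 2 + (E1 ^+ 2 + B1 ^+ 2) = r * us ^+ 2 + (E0 ^+ 2 + B0 ^+ 2)
    + 2 * dt * ((E0 + E1) / 2 * cB - (B0 + B1) / 2 * cE) + 2 * dt * r * ((us + u1) / 2 * k).
Proof.
move=> hu hE hB.
have -> : r * u1 ^+ 2 + (E1 ^+ 2 + B1 ^+ 2) = r * us ^+ 2 + (E0 ^+ 2 + B0 ^+ 2)
  + (r * (u1 + us) * (u1 - us) + (E1 + E0) * (E1 - E0) + (B1 + B0) * (B1 - B0)) by ring.
by rewrite hu hE hB; field.
Qed.

End step.

(** * Energy balance of one step *)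

Section step_balance.
Variables (R : realType) (M : nat) (dt : R) (L : 'rV[R]_3).
Local Notation vec := 'rV[R]_3.
Variables (f0 : vec -> vec -> R) (E0 B0 : vec -> vec)
  (fs : vec -> vec -> R) (rhos : vec -> R) (us : vec -> vec) (Ts : vec -> R)
  (cs : multiindex -> vec -> R)
  (f1 : vec -> vec -> R) (E1 B1 : vec -> vec)
  (rho1 : vec -> R) (u1 : vec -> vec) (T1 : vec -> R)
  (c1 : multiindex -> vec -> R).
Hypotheses (dt_neq0 : dt != 0) (rfs : regular_distribution L fs)
  (rf1 : regular_distribution L f1)
  (ms : macroscopic fs rhos us Ts) (m1 : macroscopic f1 rho1 u1 T1)
  (step : schemeI_step M dt f0 E0 B0 fs rhos us Ts cs f1 E1 B1 rho1 u1 T1 c1).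

Lemma schemeI_pointwise_balance x :
  kinetic f1 x + (sqnorm (E1 x) + sqnorm (B1 x)) =
  kinetic fs x + (sqnorm (E0 x) + sqnorm (B0 x)) +
  2 * dt * poynting (fun y => midpoint (E0 y) (E1 y))
                    (fun y => midpoint (B0 y) (B1 y)) x.
Proof.
have [_ [hB [hE [hu [/(_ x)[hrho hT] _]]]]] := step.
rewrite -(macroscopic_kinetic x ms) -(macroscopic_kinetic x m1) hrho hT.
set Em := fun y => midpoint (E0 y) (E1 y); set Bm := fun y => midpoint (B0 y) (B1 y).
pose k := cross (midpoint (us x) (u1 x)) (Bm x).
have scale (p q : vec) d : dt^-1 *: p = q -> p 0 d = dt * q 0 d.
  by move=> <-; rewrite mxE mulVKf.
have addE (p q : vec) d : (p + q) 0 d = p 0 d + q 0 d by rewrite mxE.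
have oppE (p : vec) d : (- p) 0 d = - p 0 d by rewrite mxE.
have subE (p q : vec) d : (p - q) 0 d = p 0 d - q 0 d by rewrite addE oppE.
have midE (p q : vec) d : midpoint p q 0 d = (p 0 d + q 0 d) / 2.
  by rewrite mxE addE mulrC.
have balance d := @component_balance _ dt (rhos x) (us x 0 d) (u1 x 0 d)
  (E0 x 0 d) (E1 x 0 d) (B0 x 0 d) (B1 x 0 d) (curl Em x 0 d) (curl Bm x 0 d) (k 0 d).
have {}balance d : rhos x * u1 x 0 d ^+ 2 + (E1 x 0 d ^+ 2 + B1 x 0 d ^+ 2) =
    rhos x * us x 0 d ^+ 2 + (E0 x 0 d ^+ 2 + B0 x 0 d ^+ 2)
    + 2 * dt * (Em x 0 d * curl Bm x 0 d - Bm x 0 d * curl Em x 0 d)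
    + 2 * dt * rhos x * (midpoint (us x) (u1 x) 0 d * k 0 d).
  rewrite balance.
  - by rewrite !midE.
  - by have := scale _ _ d (hu x); rewrite -/k subE addE !midE.
  - have := scale _ _ d (hE x); rewrite !subE => ->.
    (* Since the Lorentz step keeps the density, the current is that density times the midpoint
       velocity, the form in which [component_balance] cancels it. *)
    by rewrite (macroscopic_current _ _ rfs rf1 ms m1) hrho; field.
  - by have := scale _ _ d (hB x); rewrite subE oppE mulrN.
have k0 : dot (midpoint (us x) (u1 x)) k = 0 by exact: dot_cross.
have {}k0 : 2 * dt * rhos x * dot (midpoint (us x) (u1 x)) k = 0 by rewrite k0 mulr0.
(* Summed over the coordinates, the curl terms form [poynting] and the magnetic work vanishes by
   [k0]; the thermal terms are equal on both sides because the temperature is kept. *)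
have b0 := balance o0; have b1 := balance o1; have b2 := balance o2.
rewrite /poynting /sqnorm !sum3E; rewrite /dot in k0 *.
lra.
Qed.

(** Integrating the pointwise balance removes the [poynting] term by periodicity, and the transport
    step replaces the kinetic energy of [fs] by that of [f0]. *)
Lemma schemeI_energy_balance (a : vec) :
  (forall d, 0 < L 0 d) -> regular_distribution L f0 ->
  regular_field L E0 -> regular_field L B0 ->
  regular_field L E1 -> regular_field L B1 ->
  integral3 (box a L) (kinetic f1)
    + integral3 (box a L) (fun x => sqnorm (E1 x) + sqnorm (B1 x)) =
  integral3 (box a L) (kinetic f0)
    + integral3 (box a L) (fun x => sqnorm (E0 x) + sqnorm (B0 x)).
Proof.
move=> L_gt0 rf0 /regular_C1_field rE0 /regular_C1_field rB0
  /regular_C1_field rE1 /regular_C1_field rB1.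
have mB := @measurable_box R a L.
have isq F : C1_field L F -> integrable3 (box a L) (fun x => sqnorm (F x)).
  by move=> /continuous_sqnorm/(integrable_box a L).
have iW1 := integrable3D mB (isq _ rE1) (isq _ rB1).
have iW0 := integrable3D mB (isq _ rE0) (isq _ rB0).
have ik1 := integrable_kinetic a rf1; have iks := integrable_kinetic a rfs.
have [iP zP] := integral_poynting a L_gt0 (midpoint_C1_field rE0 rE1)
  (midpoint_C1_field rB0 rB1).
have [hf _] := step.
apply: etrans (esym (integral3D mB ik1 iW1)) _.
rewrite (funext schemeI_pointwise_balance).
rewrite (integral3D mB (integrable3D mB iks iW0) (integrable3Zl mB (2 * dt) iP)).
rewrite (integral3Zl mB _ iP) zP mulr0 addr0 (integral3D mB iks iW0).
exact: (congr1 (fun e => e + _) (kinetic_transport a L_gt0 dt_neq0 rf0 hf)).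
Qed.

End step_balance.

(** * Conservation of the discrete total energy *)

Unset Implicit Arguments.
Set Strict Implicit.
Local Close Scope classical_set_scope.

(* fs, rhos, us, Ts, cs at n are the starred quantities with index n + 1. *)
Theorem theorem4p1 (R : realType) (M : nat) (dt : R) (a L : 'rV[R]_3)
  (f fs : nat -> 'rV[R]_3 -> 'rV[R]_3 -> R)
  (E B : nat -> 'rV[R]_3 -> 'rV[R]_3)
  (rho rhos : nat -> 'rV[R]_3 -> R)
  (u us : nat -> 'rV[R]_3 -> 'rV[R]_3)
  (T Ts : nat -> 'rV[R]_3 -> R)
  (c cs : nat -> multiindex -> 'rV[R]_3 -> R)
  (dt_gt0 : 0 < dt)
  (L_gt0 : forall d : 'I_3, 0 < L 0 d)
  (f_regular : forall n, regular_distribution L (f n))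
  (fs_regular : forall n, regular_distribution L (fs n))
  (E_regular : forall n, regular_field L (E n))
  (B_regular : forall n, regular_field L (B n))
  (f_macroscopic : forall n, macroscopic (f n) (rho n) (u n) (T n))
  (fs_macroscopic : forall n, macroscopic (fs n) (rhos n) (us n) (Ts n))
  (f_schemeI : forall n,
     schemeI_step M dt (f n) (E n) (B n)
       (fs n) (rhos n) (us n) (Ts n) (cs n)
       (f n.+1) (E n.+1) (B n.+1)
       (rho n.+1) (u n.+1) (T n.+1) (c n.+1)) :
  forall n : nat,
    total_energy (box a L) (rho n.+1) (u n.+1) (T n.+1) (E n.+1) (B n.+1)
    = total_energy (box a L) (rho n) (u n) (T n) (E n) (B n).
Proof.
move=> n.
have dt_neq0 : dt != 0 by rewrite gt_eqF.
have := schemeI_energy_balance dt_neq0 (fs_regular n) (f_regular n.+1)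
  (fs_macroscopic n) (f_macroscopic n.+1) (f_schemeI n) a L_gt0 (f_regular n)
  (E_regular n) (B_regular n) (E_regular n.+1) (B_regular n.+1).
move=> balance; rewrite /total_energy -!mulrDr.
(* With the common factor one half taken out, the macroscopic energy densities become second
   moments, as in the balance of one step. *)
rewrite (funext (fun x => macroscopic_kinetic x (f_macroscopic n))).
rewrite (funext (fun x => macroscopic_kinetic x (f_macroscopic n.+1))).
exact: (congr1 (fun e => 1 / 2 * e) balance).
Qed.
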